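(* Let $X$ be a space and let $\mathscr{I}$ be a $\sigma$-ideal in an upper semi-lattice $(\mathscr{L},\subseteq)$, where $\mathscr{L}\subseteq\mathscr{P}(X)$. Then \[C^{\mathscr I}_0(X)=\big\{f\in C_b(X):\mathrm{coz}(f)\text{ has a null neighborhood in }X\big\}.\] In particular, if $\mathrm{Coz}(X)\subseteq\mathscr{L}$, then \[C^{\mathscr I}_0(X)=\big\{f\in C_b(X):\mathrm{coz}(f)\text{ is null}\big\}.\]
   Context: A space is a topological space and $\mathscr{P}(X)$ is the power set of $X$. $C_b(X)$ is the algebra of continuous bounded $f:X\to\mathbb{R}$; $\mathrm{coz}(f)=X\setminus f^{-1}(0)$, and $\mathrm{Coz}(X)$ is the set of all cozero-sets of continuous real-valued functions on $X$. An upper semi-lattice is a partially ordered set in which any two elements $A,B$ have a least upper bound $A\vee B$. For $\mathscr{L}\subseteq\mathscr{P}(X)$ ordered by inclusion, least upper bounds are computed in $\mathscr{L}$ and need not be unions. An ideal $\mathscr{I}$ in $(\mathscr{L},\subseteq)$ is a non-empty subset of $\mathscr{L}$ such that $A\vee B\in\mathscr{I}$ whenever $A,B\in\mathscr{I}$, and $T\in\mathscr{I}$ whenever $T\in\mathscr{L}$ and $T\subseteq A$ for some $A\in\mathscr{I}$. When $\mathscr{L}$ contains least upper bounds of all its countable subsets (this is part of the assumption whenever $\sigma$-ideals are mentioned), $\mathscr{I}$ is a $\sigma$-ideal if moreover $\bigvee\mathscr{J}\in\mathscr{I}$ for every countable $\mathscr{J}\subseteq\mathscr{I}$. Elements of $\mathscr{I}$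 are called null. A neighborhood of a set $A$ in $X$ is a set $U\subseteq X$ with $A\subseteq\mathrm{int}_XU$. $C^{\mathscr I}_0(X)=\{f\in C_b(X):|f|^{-1}([1/n,\infty))\text{ has a null neighborhood in }X\text{ for each positive integer }n\}$. *)

(* Defs.v *)
From mathcomp Require Import all_boot all_order all_algebra.
From mathcomp Require Import all_classical all_reals all_analysis.

Set Implicit Arguments.
Unset Strict Implicit.
Unset Printing Implicit Defensive.

Import Order.TTheory GRing.Theory Num.Theory.
Import numFieldNormedType.Exports.

Local Open Scope classical_set_scope.
Local Open Scope ring_scope.

Section SetLattices.
Variable X : Type.
Implicit Types (L I J : set (set X)) (A B S T : set X).

(* The bound is the least one among the members of [L] only, so it need not be
   the union of [J]. *)
Definition is_lub L J S : Prop :=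
  [/\ L S,
      (forall A, J A -> A `<=` S) &
      (forall T, L T -> (forall A, J A -> A `<=` T) -> S `<=` T)].

Definition upper_semilattice L : Prop :=
  forall A B, L A -> L B -> exists S, is_lub L [set A; B] S.

(* [countable] includes the finite families, in particular the empty one. *)
Definition has_countable_lubs L : Prop :=
  forall J, J `<=` L -> countable J -> exists S, is_lub L J S.

Definition is_ideal L I : Prop :=
  [/\ I `<=` L,
      I !=set0,
      (forall A B S, I A -> I B -> is_lub L [set A; B] S -> I S) &
      (forall A T, I A -> L T -> T `<=` A -> I T)].

Definition is_sigma_ideal L I : Prop :=
  is_ideal L I /\
  (forall J S, J `<=` I -> countable J -> is_lub L J S -> I S).

End SetLattices.

Section Functions.
Variables (R : realType) (X : topologicalType).
Implicit Types (I : set (set X)) (f : X -> R) (A U : set X).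

Definition nbhd_of A U : Prop := A `<=` U°.

Definition has_null_nbhd I A : Prop := exists2 U, I U & nbhd_of A U.

Definition Cb : set (X -> R) := [set f | continuous f /\ bounded_fun f].

Definition coz f : set X := ~` (f @^-1` [set 0]).

Definition Coz : set (set X) := [set coz f | f in [set f | continuous f]].

Definition C0 I : set (X -> R) :=
  [set f | Cb f /\
    forall n : nat, (0 < n)%N ->
      has_null_nbhd I ((fun x => `|f x|) @^-1` `[n%:R^-1, +oo[)].

End Functions.

Arguments Cb : clear implicits.
Arguments Coz : clear implicits.
Arguments C0 R {X} I.

(* Main.v *)
Require Import Defs.
From mathcomp Require Import all_boot all_order all_algebra.
From mathcomp Require Import all_classical all_reals all_analysis.

(** The cozero-set of [f] is the increasing union of the countably many level
    sets [|f| >= 1/n].  Null neighborhoods [U n] of these sets have a least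
    upper bound [S] in the lattice; [S] is null because the ideal is
    sigma-complete, and although [S] may be larger than the union of the [U n],
    it contains each of them, so its interior contains every level set and
    hence the cozero-set ([has_null_nbhd_bigcup]).  Conversely a null
    neighborhood of the cozero-set is one of each level set.  When cozero-sets
    belong to the lattice, the cozero-set is null as soon as some null
    neighborhood contains it, and, being open ([open_coz]), is its own
    neighborhood when it is null. *)

Import Order.TTheory GRing.Theory Num.Theory.
Import numFieldNormedType.Exports.

Local Open Scope classical_set_scope.

Section NullNeighborhoods.
Variable X : topologicalType.
Implicit Types (L I : set (set X)) (A B U : set X).

Lemma has_null_nbhdS I A B :
  A `<=` B -> has_null_nbhd I B -> has_null_nbhd I A.
Proof. by move=> AB [U IU BU]; exists U => // x /AB /BU. Qed.

(** The least upper bound of a choice of null neighborhoods is null by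
    sigma-completeness; its interior contains that of each of them by
    monotonicity of the interior, whether or not the bound is their union. *)
Lemma has_null_nbhd_bigcup L I (A : nat -> set X) :
  has_countable_lubs L -> is_sigma_ideal L I ->
  (forall n, has_null_nbhd I (A n)) -> has_null_nbhd I (\bigcup_n A n).
Proof.
move=> lubL [[IL _ _ _] lubI] nullA.
have /choice[U UP] : forall n, exists U, I U /\ nbhd_of (A n) U.
  by move=> n; have [U IU AU] := nullA n; exists U.
have UI : range U `<=` I by move=> _ [n _ <-]; have [] := UP n.
have cU : countable (range U) by exact: card_image_le.
have [S lubS] := lubL _ (subset_trans UI IL) cU.
exists S; first exact: lubI UI cU lubS.
have [_ ubS _] := lubS.
move=> x [n _ Anx]; have [_ AU] := UP n.
by apply: (interiorS (ubS (U n) _)); [exists n | exact: AU].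
Qed.

Lemma null_of_has_null_nbhd L I A :
  is_ideal L I -> L A -> has_null_nbhd I A -> I A.
Proof.
move=> [_ _ _ downI] LA [U IU AU]; apply: (downI U) => //.
exact: subset_trans AU (@interior_subset _ U).
Qed.

Lemma has_null_nbhd_open I A : open A -> I A -> has_null_nbhd I A.
Proof. by move=> oA IA; exists A => //; rewrite /nbhd_of -open_subsetE. Qed.

End NullNeighborhoods.

Section CozeroSets.
Variables (R : realType) (X : topologicalType).
Implicit Type f : X -> R.

Lemma open_coz f : continuous f -> open (coz f).
Proof.
move=> cf; apply: closed_openC; apply: preimage_closed => [x _|]; first exact: cf.
exact: closed_eq.
Qed.

Lemma level_sub_coz f (n : nat) : (0 < n)%N ->
  (fun x => `|f x|%R) @^-1` `[n%:R^-1%R, +oo[ `<=` coz f.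
Proof.
move=> n0 x; rewrite /= in_itv /= andbT => nfx fx0; move: nfx.
by rewrite fx0 normr0 leNgt invr_gt0 ltr0n n0.
Qed.

(** The Archimedean property: a nonzero [|f x|] exceeds some [1/(n+1)]. *)
Lemma coz_sub_bigcup_level f :
  coz f `<=`
  \bigcup_(n : nat) ((fun x => `|f x|%R) @^-1` `[n.+1%:R^-1%R, +oo[).
Proof.
move=> x /eqP; rewrite -normr_gt0 => /ltr_add_invr[n].
rewrite add0r => nfx; exists n => //=.
by rewrite in_itv /= andbT ltW.
Qed.

End CozeroSets.

Theorem proposition3p4 (R : realType) (X : topologicalType)
    (L I : set (set X))
    (hL : upper_semilattice L) (hLsigma : has_countable_lubs L)
    (hI : is_sigma_ideal L I) :
  C0 R I = [set f | Cb R X f /\ has_null_nbhd I (coz f)] /\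
  (Coz R X `<=` L -> C0 R I = [set f | Cb R X f /\ I (coz f)]).
Proof.
have C0E : C0 R I = [set f | Cb R X f /\ has_null_nbhd I (coz f)].
  apply/seteqP; split => f [Cbf nullf]; split=> //.
    apply: has_null_nbhdS (@coz_sub_bigcup_level _ _ f) _.
    by apply: (has_null_nbhd_bigcup _ _ _ _ hLsigma hI) => n; exact: nullf.
  by move=> n n0; apply: has_null_nbhdS nullf; exact: level_sub_coz.
split=> // CozL; rewrite C0E.
apply/seteqP; split => f [Cbf nullf]; split=> //; have [cf _] := Cbf.
  by apply: (null_of_has_null_nbhd _ _ _ _ hI.1) nullf; apply: CozL; exists f.
by apply: has_null_nbhd_open nullf; exact: open_coz.
Qed.
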